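(* Let $A$, $B$ and $C$ be super algebras, let $M$ be an $A$-$B$-bimodule and let $N$ be a $B$-$C$-bimodule. (1) If $M$ is implementing and $N$ is left implementing, then the $A$-$C$-bimodule $M \otimes_B N$ is left implementing. (2) If $M$ is right implementing and $N$ is implementing, then $M \otimes_B N$ is right implementing. (3) If $M$ and $N$ are implementing, then $M \otimes_B N$ is implementing.
   Context: Let $k=\mathbb{R}$ or $k=\mathbb{C}$. A super algebra is a finite-dimensional, $\mathbb{Z}_2$-graded, unital, associative $k$-algebra; super algebra homomorphisms are even (parity-preserving) unital algebra homomorphisms, and $\mathrm{Aut}(A)$ denotes the Lie group of even algebra automorphisms of $A$. An $A$-$B$-bimodule is a finite-dimensional $\mathbb{Z}_2$-graded $A$-$B$-bimodule over $k$; actions are written $a\triangleright m$ and $m\triangleleft b$. $M\otimes_B N$ is the usual relative tensor product with its induced grading and $A$-$C$-bimodule structure. For an $A$-$B$-bimodule $M$, the group of implementers $I(M)$ is the group of triples $(\phi,u,\psi)$ with $\phi\in\mathrm{Aut}(A)$, $\psi\in\mathrm{Aut}(B)$ and $u:M\to M$ an even invertible linear map satisfying $u(a\triangleright m\triangleleft b)=\phi(a)\triangleright u(m)\triangleleft\psi(b)$ for all $a\in A$, $m\in M$, $b\in B$. It is a closed subgroup of $\mathrm{Aut}(A)\times\mathrm{GL}(M)\times\mathrm{Aut}(B)$, hence a Lie group. Let $p_\ell:I(M)\to\mathrm{Aut}(A)$ and $p_r:I(M)\to\mathrm{Aut}(B)$ be the projections. $M$ is left implementing if $p_\ell$ is an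 open map, right implementing if $p_r$ is an open map, and implementing if it is both left and right implementing. *)

(* Defs.v *)
From HB Require Import structures.
From mathcomp Require Import all_boot all_order all_algebra.
From mathcomp Require Import all_classical all_reals topology normedtype.
From mathcomp Require Import complex.

Set Implicit Arguments.
Unset Strict Implicit.
Unset Printing Implicit Defensive.

Import Order.TTheory GRing.Theory Num.Theory.
Import numFieldNormedType.Exports.

Local Open Scope classical_set_scope.
Local Open Scope ring_scope.

Reserved Notation "a ▷ m" (at level 40, left associativity).
Reserved Notation "m ◁ b" (at level 40, left associativity).
Reserved Notation "M ⊗ N" (at level 40, left associativity).

Variant real_or_complex (R : realType) : numFieldType -> Prop :=
  | IsReal : real_or_complex R R
  | IsComplex : real_or_complex R R[i].

(* Z_2 is encoded as bool, with addition (+): grade false is the even part and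
   grade true the odd part. *)
HB.mixin Record hasGrading (K : fieldType) V of Vector K V := {
  grade : bool -> {vspace V};
  grade_sum : (grade false + grade true)%VS = fullv;
  grade_cap : (grade false :&: grade true)%VS = 0%VS
}.

#[short(type="superVectType")]
HB.structure Definition SuperVector (K : fieldType) :=
  { V of Vector K V & hasGrading K V }.

Section ProjGrade.
Variables (K : fieldType) (V : superVectType K).
Implicit Types (i : bool) (v x y : V).

Definition proj_grade i : 'End(V) := daddv_pi (grade i) (grade (~~ i)).

Lemma grade_capN i : (grade i :&: grade (~~ i) = 0 :> {vspace V})%VS.
Proof. by case: i; rewrite ?[(grade true :&: _)%VS]capvC grade_cap. Qed.

Lemma proj_grade_mem i v : proj_grade i v \in grade i.
Proof. exact: memv_pi. Qed.

Lemma proj_grade_sum i v : v = proj_grade i v + proj_grade (~~ i) v.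
Proof.
rewrite -[LHS](@daddv_pi_add _ _ (grade i) (grade (~~ i))) ?grade_capN //.
  by rewrite /proj_grade negbK.
by case: i; rewrite ?[(grade true + _)%VS]addvC grade_sum memvf.
Qed.

Lemma proj_grade_id i v : v \in grade i -> proj_grade i v = v.
Proof. exact/daddv_pi_id/grade_capN. Qed.

Lemma proj_grade0 i v : v \in grade (~~ i) -> proj_grade i v = 0.
Proof.
move=> /proj_grade_id vi; have := proj_grade_sum i v; rewrite vi.
by rewrite -{1}[v]add0r => /addIr.
Qed.

Lemma proj_gradeD i x y :
  x \in grade i -> y \in grade (~~ i) -> proj_grade i (x + y) = x.
Proof.
by move=> xi yi; rewrite linearD /= proj_grade_id // proj_grade0 ?addr0.
Qed.
End ProjGrade.
Arguments proj_grade {K V} i.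

(* The library's algebra structures (lalgType, falgType, and so on) are not used
   because they exclude the zero algebra.  That the unit is even follows from
   grade_amul. *)
HB.mixin Record isSuperAlgebra (K : fieldType) A of SuperVector K A := {
  amul : A -> A -> A;
  aone : A;
  amul_linearl : forall y, linear (amul^~ y);
  amul_linearr : forall x, linear (amul x);
  amulA : associative amul;
  amul1a : left_id aone amul;
  amula1 : right_id aone amul;
  grade_amul : forall i j x y,
    x \in grade i -> y \in grade j -> amul x y \in grade (i (+) j)
}.

#[short(type="superAlgType")]
HB.structure Definition SuperAlgebra (K : fieldType) :=
  { A of SuperVector K A & isSuperAlgebra K A }.

HB.mixin Record isBimodule (K : fieldType) (A B : superAlgType K) M
    of SuperVector K M := {
  lact : A -> M -> M;
  ract : M -> B -> M;
  lact_linearl : forall m, linear (lact^~ m);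
  lact_linearr : forall a, linear (lact a);
  ract_linearl : forall b, linear (ract^~ b);
  ract_linearr : forall m, linear (ract m);
  lact1 : forall m, lact aone m = m;
  lactA : forall a a' m, lact (amul a a') m = lact a (lact a' m);
  ract1 : forall m, ract m aone = m;
  ractA : forall m b b', ract m (amul b b') = ract (ract m b) b';
  lractA : forall a m b, ract (lact a m) b = lact a (ract m b);
  grade_lact : forall i j a m,
    a \in grade i -> m \in grade j -> lact a m \in grade (i (+) j);
  grade_ract : forall i j m b,
    m \in grade i -> b \in grade j -> ract m b \in grade (i (+) j)
}.

#[short(type="bimodType")]
HB.structure Definition Bimodule (K : fieldType) (A B : superAlgType K) :=
  { M of SuperVector K M & isBimodule K A B M }.

Notation "a ▷ m" := (lact a m) : ring_scope.
Notation "m ◁ b" := (ract m b) : ring_scope.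

Lemma linear_morphD (K : fieldType) (V W : lmodType K) (f : V -> W) :
  linear f -> {morph f : x y / x + y}.
Proof. by move=> lf x y; rewrite -[x]scale1r lf !scale1r. Qed.

Lemma linear_morph0 (K : fieldType) (V W : lmodType K) (f : V -> W) :
  linear f -> f 0 = 0.
Proof.
by move=> lf; apply: (addrI (f 0)); rewrite -(linear_morphD lf) !addr0.
Qed.

Section ProjGradeAct.
Variables (K : fieldType) (A B : superAlgType K) (M : bimodType A B).

Lemma proj_grade_ract i (m : M) (b : B) : proj_grade i (m ◁ b) =
  proj_grade i m ◁ proj_grade false b
  + proj_grade (~~ i) m ◁ proj_grade true b.
Proof.
have -> : m ◁ b =
    (proj_grade i m ◁ proj_grade false b
     + proj_grade (~~ i) m ◁ proj_grade true b)
  + (proj_grade (~~ i) m ◁ proj_grade false b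
     + proj_grade i m ◁ proj_grade true b).
  rewrite {1}(proj_grade_sum i m) {1}(proj_grade_sum false b).
  rewrite (linear_morphD (ract_linearr _)) !(linear_morphD (ract_linearl _)) /=.
  by rewrite [X in _ + X]addrC addrACA.
have mem j k : proj_grade j m ◁ proj_grade k b \in grade (j (+) k).
  by apply: grade_ract; exact: proj_grade_mem.
apply: proj_gradeD; apply: memvD; [have := mem i false | have := mem (~~ i) true |
  have := mem (~~ i) false | have := mem i true]; by rewrite ?addbF ?addbT ?negbK.
Qed.

Lemma proj_grade_lact i (a : A) (m : M) : proj_grade i (a ▷ m) =
  proj_grade false a ▷ proj_grade i m
  + proj_grade true a ▷ proj_grade (~~ i) m.
Proof.
have -> : a ▷ m =
    (proj_grade false a ▷ proj_grade i m
     + proj_grade true a ▷ proj_grade (~~ i) m)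
  + (proj_grade false a ▷ proj_grade (~~ i) m
     + proj_grade true a ▷ proj_grade i m).
  rewrite {1}(proj_grade_sum false a) {1}(proj_grade_sum i m).
  rewrite (linear_morphD (lact_linearl _)) !(linear_morphD (lact_linearr _)) /=.
  by rewrite [X in _ + X]addrC addrACA.
have mem k j : proj_grade k a ▷ proj_grade j m \in grade (k (+) j).
  by apply: grade_lact; exact: proj_grade_mem.
apply: proj_gradeD; apply: memvD; [have := mem false i | have := mem true (~~ i) |
  have := mem false (~~ i) | have := mem true i]; by rewrite ?addFb ?addTb ?negbK.
Qed.
End ProjGradeAct.

Lemma linear_coord (K : fieldType) (V W : vectType K) (f : V -> W) v :
  linear f ->
  f v = \sum_i coord (vbasis {:V}) i v *: f (vbasis {:V})`_i.
Proof.
move=> lf.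
pose ff : {linear V -> W} := HB.pack f (GRing.isLinear.Build _ _ _ _ f lf).
rewrite -[f]/(ff : V -> W) {1}(coord_vbasis (memvf v)) linear_sum.
by apply: eq_bigr => i _; rewrite linearZ.
Qed.

Lemma linear_memv (K : fieldType) (V W : vectType K) (f : V -> W)
    (S : {vspace V}) (U : {vspace W}) :
  linear f -> {in vbasis S, forall v, f v \in U} ->
  forall v, v \in S -> f v \in U.
Proof.
move=> lf fU v /coord_vbasis ->.
pose ff : {linear V -> W} := HB.pack f (GRing.isLinear.Build _ _ _ _ f lf).
rewrite -[f]/(ff : V -> W) linear_sum; apply: memv_suml => i _.
by rewrite linearZ; apply/memvZ/fU/mem_nth; rewrite size_tuple.
Qed.

Section TensorProduct.
Variables (K : fieldType) (A B C : superAlgType K).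
Variables (M : bimodType A B) (N : bimodType B C).

(* M (x)_K N is modelled by matrices: the elementary tensor of m and n is the
   outer product of their coordinate vectors. *)
Definition outer (m : M) (n : N) : 'M[K]_(\dim {:M}, \dim {:N}) :=
  \matrix_(i, j) (coord (vbasis {:M}) i m * coord (vbasis {:N}) j n).

Definition relator (m : M) (b : B) (n : N) :=
  outer (m ◁ b) n - outer m (b ▷ n).

(* By trilinearity, the relators of basis elements span all relators. *)
Definition relators : {vspace 'M[K]_(\dim {:M}, \dim {:N})} :=
  <<[seq relator m bn.1 bn.2 | m <- vbasis {:M},
      bn <- [seq (b, n) | b <- vbasis {:B}, n <- vbasis {:N}]]>>%VS.

(* The quotient of M (x)_K N by the relators, realised on a complement. *)
Definition tensor : Type := subvs_of (relators^C)%VS.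

HB.instance Definition _ := Vector.on tensor.

Definition tensor_proj : 'Hom('M[K]_(\dim {:M}, \dim {:N}), tensor) :=
  (linfun (vsproj relators^C) \o daddv_pi relators^C relators)%VF.

Definition mtens (m : M) (n : N) : tensor := tensor_proj (outer m n).

(* tensor_proj is indeed a quotient map by the relators. *)
Lemma tensor_proj_surj (t : tensor) : tensor_proj (vsval t) = t.
Proof.
by rewrite comp_lfunE lfunE /= daddv_pi_id ?subvsP ?vsvalK // capvC capv_compl.
Qed.

Lemma tensor_projK X : X - vsval (tensor_proj X) \in relators.
Proof.
have dx : (relators^C :&: relators = 0)%VS by rewrite capvC capv_compl.
have aX : X \in (relators^C + relators)%VS by rewrite addvC addv_complf memvf.
rewrite -{1}(daddv_pi_add dx aX) comp_lfunE lfunE /= vsprojK ?memv_pi //.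
by rewrite addrAC subrr add0r memv_pi.
Qed.

Lemma lker_tensor_proj : lker tensor_proj = relators.
Proof.
apply/vspaceP => X; rewrite memv_ker; apply/eqP/idP => [X0 | RX].
  by have := tensor_projK X; rewrite X0 raddf0 addr0.
have: vsval (tensor_proj X) \in (relators :&: relators^C)%VS.
  rewrite memv_cap subvsP andbT -[vsval _](subKr X).
  by rewrite memvB ?tensor_projK.
by rewrite capv_compl memv0 => /eqP X0; apply: val_inj.
Qed.

Lemma outer_linearl n : linear (outer^~ n).
Proof.
by move=> k x y; apply/matrixP => i j; rewrite !mxE linearP mulrDl mulrA.
Qed.

Lemma outer_linearr m : linear (outer m).
Proof.
by move=> k x y; apply/matrixP => i j; rewrite !mxE linearP mulrDr mulrCA.
Qed.

Lemma mtens_linearl n : linear (mtens^~ n).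
Proof. by move=> k x y; rewrite /mtens outer_linearl linearP. Qed.

Lemma mtens_linearr m : linear (mtens m).
Proof. by move=> k x y; rewrite /mtens outer_linearr linearP. Qed.

Lemma relatorP m b n : relator m b n \in relators.
Proof.
have lin3 (p q r s : 'M[K]_(\dim {:M}, \dim {:N})) k :
    k *: p + q - (k *: r + s) = k *: (p - r) + (q - s).
  by rewrite scalerBr opprD addrACA.
apply: (@linear_memv _ _ _ (relator^~ b ^~ n) {:M}); last exact: memvf.
  move=> k x y; rewrite /relator ract_linearl !outer_linearl.
  exact: lin3.
move=> {}m mM /=.
apply: (@linear_memv _ _ _ ((relator m)^~ n) {:B}); last exact: memvf.
  move=> k x y; rewrite /relator ract_linearr lact_linearl.
  by rewrite outer_linearl outer_linearr lin3.
move=> {}b bB /=.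
apply: (@linear_memv _ _ _ (relator m b) {:N}); last exact: memvf.
  by move=> k x y; rewrite /relator lact_linearr !outer_linearr lin3.
move=> {}n nN /=; apply: memv_span.
apply/allpairsP; exists (m, (b, n)); split => //=.
by apply/allpairsP; exists (b, n).
Qed.

Lemma mtens_balanced m b n : mtens (m ◁ b) n = mtens m (b ▷ n).
Proof.
apply/eqP; rewrite -subr_eq0 -linearB -memv_ker lker_tensor_proj.
exact: relatorP.
Qed.

Lemma outer_vbasis (i : 'I_(\dim {:M})) (j : 'I_(\dim {:N})) :
  outer (vbasis {:M})`_i (vbasis {:N})`_j = delta_mx i j.
Proof.
apply/matrixP => i' j'; rewrite !mxE !coord_free ?(basis_free (vbasisP _)) //.
by rewrite -natrM mulnb eq_sym [j == _]eq_sym.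
Qed.

Lemma tensor_coord (t : tensor) : t = \sum_i \sum_j
  vsval t i j *: mtens (vbasis {:M})`_i (vbasis {:N})`_j.
Proof.
rewrite -[LHS]tensor_proj_surj {1}[vsval t]matrix_sum_delta linear_sum.
apply: eq_bigr => i _; rewrite linear_sum; apply: eq_bigr => j _.
by rewrite linearZ /mtens outer_vbasis.
Qed.

Lemma tensor_memv (W : vectType K) (f : tensor -> W) (U : {vspace W}) :
  linear f -> (forall m n, f (mtens m n) \in U) -> forall t, f t \in U.
Proof.
move=> lf fU t; rewrite (tensor_coord t).
pose ff : {linear tensor -> W} := HB.pack f (GRing.isLinear.Build _ _ _ _ f lf).
rewrite -[f]/(ff : tensor -> W) linear_sum; apply: memv_suml => i _.
rewrite linear_sum; apply: memv_suml => j _.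
by rewrite linearZ memvZ ?fU.
Qed.

Lemma tensor_ext (W : vectType K) (f g : tensor -> W) :
  linear f -> linear g ->
  (forall m n, f (mtens m n) = g (mtens m n)) -> f =1 g.
Proof.
move=> lf lg fg t; apply/eqP; rewrite -subr_eq0 -memv0.
apply: (@tensor_memv W (fun t => f t - g t)) => [k x y|m n].
  by rewrite lf lg scalerBr opprD addrACA.
by rewrite fg subrr mem0v.
Qed.

Section Lift.
Variables (W : vectType K) (beta : M -> N -> W).

Definition outer_lift (X : 'M[K]_(\dim {:M}, \dim {:N})) : W :=
  \sum_i \sum_j X i j *: beta (vbasis {:M})`_i (vbasis {:N})`_j.

Definition tensor_lift (t : tensor) : W := outer_lift (vsval t).

Lemma outer_lift_linear : linear outer_lift.
Proof.
move=> k X Y; rewrite /outer_lift scaler_sumr -big_split; apply: eq_bigr => i _.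
rewrite scaler_sumr -big_split; apply: eq_bigr => j _.
by rewrite !mxE scalerDl scalerA.
Qed.

HB.instance Definition _ :=
  GRing.isLinear.Build K _ W _ outer_lift outer_lift_linear.

Lemma tensor_lift_linear : linear tensor_lift.
Proof.
by move=> k s t; rewrite /tensor_lift !linearP.
Qed.

Hypothesis beta_linearl : forall n, linear (beta^~ n).
Hypothesis beta_linearr : forall m, linear (beta m).
Hypothesis beta_balanced : forall m b n, beta (m ◁ b) n = beta m (b ▷ n).

Lemma outer_lift_outer m n : outer_lift (outer m n) = beta m n.
Proof.
rewrite (linear_coord m (beta_linearl n)); apply: eq_bigr => i _.
rewrite (linear_coord n (beta_linearr _)) scaler_sumr; apply: eq_bigr => j _.
by rewrite scalerA mxE.
Qed.

(* Together with tensor_ext, this is the universal property. *)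
Lemma tensor_liftE m n : tensor_lift (mtens m n) = beta m n.
Proof.
have: outer m n - vsval (mtens m n) \in lker (linfun outer_lift).
  move: (tensor_projK (outer m n)); apply: subvP.
  apply/span_subvP => _ /allpairsP[[m' [b' n']] /= [_ _ ->]].
  rewrite memv_ker lfunE /= /relator linearB /= !outer_lift_outer.
  by rewrite beta_balanced subrr.
rewrite memv_ker lfunE /= linearB /= subr_eq0 outer_lift_outer => /eqP eqm.
by rewrite /tensor_lift eqm.
Qed.
End Lift.

Definition tensor_grade (k : bool) : {vspace tensor} :=
  (\sum_(i : bool) <<[seq mtens m n | m <- vbasis (grade i : {vspace M}),
                       n <- vbasis (grade (i (+) k) : {vspace N})]>>)%VS.

Definition tensor_lact (a : A) : tensor -> tensor :=
  tensor_lift (fun m n => mtens (a ▷ m) n).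

Definition tensor_ract (t : tensor) (c : C) : tensor :=
  tensor_lift (fun m n => mtens m (n ◁ c)) t.

Lemma tensor_lactE a m n : tensor_lact a (mtens m n) = mtens (a ▷ m) n.
Proof.
apply: tensor_liftE => [n' k x y|m' k x y|m' b n'].
- by rewrite lact_linearr mtens_linearl.
- by rewrite mtens_linearr.
- by rewrite -lractA mtens_balanced.
Qed.

Lemma tensor_ractE m n c : tensor_ract (mtens m n) c = mtens m (n ◁ c).
Proof.
apply: tensor_liftE => [n' k x y|m' k x y|m' b n'].
- by rewrite mtens_linearl.
- by rewrite ract_linearl mtens_linearr.
- by rewrite mtens_balanced lractA.
Qed.

Lemma mtens_grade i j m n :
  m \in grade i -> n \in grade j -> mtens m n \in tensor_grade (i (+) j).
Proof.
move=> mi nj; suff: mtens m n \in <<[seq mtens m n |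
    m <- vbasis (grade i : {vspace M}),
    n <- vbasis (grade (i (+) (i (+) j)) : {vspace N})]>>%VS.
  apply: subvP; exact: (sumv_sup i).
rewrite addbA addbb addFb.
apply: (@linear_memv _ _ _ (mtens^~ n) (grade i)) mi => [|{}m mi].
  exact: mtens_linearl.
apply: (@linear_memv _ _ _ (mtens m) (grade j)) nj => [|{}n nj].
  exact: mtens_linearr.
by apply/memv_span/allpairsP; exists (m, n).
Qed.

Lemma tensor_grade_memv (W : vectType K) (f : tensor -> W) k (U : {vspace W}) :
    linear f ->
    (forall i j m n, i (+) j = k -> m \in grade i -> n \in grade j ->
      f (mtens m n) \in U) ->
  forall t, t \in tensor_grade k -> f t \in U.
Proof.
move=> lf fU t kt.
pose ff : {linear tensor -> W} := HB.pack f (GRing.isLinear.Build _ _ _ _ f lf).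
have -> : f t = linfun ff t by rewrite lfunE.
rewrite memv_preim; apply: subvP kt.
apply/subv_sumP => i _; apply/span_subvP => _ /allpairsP[[m n] /= [mi nj ->]].
rewrite -memv_preim (lfunE ff); apply: (fU i (i (+) k)); rewrite ?vbasis_mem //.
by rewrite addbA addbb.
Qed.

Definition tensor_even : tensor -> tensor := tensor_lift (fun m n =>
  mtens (proj_grade false m) (proj_grade false n)
  + mtens (proj_grade true m) (proj_grade true n)).

Lemma tensor_evenE m n : tensor_even (mtens m n) =
  mtens (proj_grade false m) (proj_grade false n)
  + mtens (proj_grade true m) (proj_grade true n).
Proof.
apply: tensor_liftE => [n' k x y|m' k x y|m' b n'].
- by rewrite !linearP !mtens_linearl scalerDr addrACA.
- by rewrite !linearP !mtens_linearr scalerDr addrACA.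
have Dl := linear_morphD (mtens_linearl _).
have Dr := linear_morphD (mtens_linearr _).
rewrite !proj_grade_ract !proj_grade_lact !{}Dl !{}Dr !mtens_balanced.
by rewrite addrACA [X in _ + X]addrC addrACA.
Qed.

Fact tensor_grade_sum :
  (tensor_grade false + tensor_grade true)%VS = fullv.
Proof.
have mem k t :
    t \in tensor_grade k -> t \in (tensor_grade false + tensor_grade true)%VS.
  by apply: subvP; case: k; rewrite ?addvSl ?addvSr.
apply/vspaceP => t; rewrite memvf; move: t.
apply: (@tensor_memv _ id) => // m n.
rewrite {1}(proj_grade_sum false m) {1}(proj_grade_sum false n).
rewrite (linear_morphD (mtens_linearl _)) !(linear_morphD (mtens_linearr _)).
rewrite !memvD //.
all: exact: mem _ _ (mtens_grade (proj_grade_mem _ _) (proj_grade_mem _ _)).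
Qed.

Fact tensor_grade_cap : (tensor_grade false :&: tensor_grade true)%VS = 0%VS.
Proof.
have lT : linear tensor_even by exact: tensor_lift_linear.
apply/eqP; rewrite -subv0; apply/subvP => t; rewrite memv_cap => /andP[t0 t1].
have E0 : tensor_even t = 0.
  apply/eqP; rewrite -memv0.
  apply: (tensor_grade_memv lT _ t1) => -[] [] m n // _ mi nj.
    rewrite tensor_evenE (proj_grade0 (i := false) mi).
    rewrite (proj_grade0 (i := true) nj) (linear_morph0 (mtens_linearl _)).
    by rewrite (linear_morph0 (mtens_linearr _)) addr0 mem0v.
  rewrite tensor_evenE (proj_grade0 (i := true) mi).
  rewrite (proj_grade0 (i := false) nj) (linear_morph0 (mtens_linearl _)).
  by rewrite (linear_morph0 (mtens_linearr _)) addr0 mem0v.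
rewrite -[t]subr0 -E0.
apply: (@tensor_grade_memv _ (fun t => t - tensor_even t) false _ _ _ _ t0).
  move=> k x y.
  by rewrite lT scalerBr opprD addrACA.
move=> i j m n ij mi nj; rewrite tensor_evenE.
case: i j ij mi nj => [] [] // _ mi nj.
- rewrite (proj_grade0 (i := false) mi) (linear_morph0 (mtens_linearl _)) add0r.
  by rewrite !proj_grade_id // subrr mem0v.
- rewrite (proj_grade0 (i := true) mi) (linear_morph0 (mtens_linearl _)) addr0.
  by rewrite !proj_grade_id // subrr mem0v.
Qed.

HB.instance Definition _ := hasGrading.Build K tensor
  tensor_grade_sum tensor_grade_cap.

Fact tensor_lact_linearl t : linear (tensor_lact^~ t).
Proof.
move=> k a b /=; move: t; apply: tensor_ext => [|k' x y|m n].
- exact: tensor_lift_linear.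
- rewrite /tensor_lact !tensor_lift_linear !scalerDr !scalerA [k' * k]mulrC.
  by rewrite -!addrA; congr (_ + _); rewrite addrCA.
- by rewrite !tensor_lactE lact_linearl mtens_linearl.
Qed.

Fact tensor_lact_linearr a : linear (tensor_lact a).
Proof. exact: tensor_lift_linear. Qed.

Fact tensor_ract_linearl c : linear (tensor_ract^~ c).
Proof. exact: tensor_lift_linear. Qed.

Fact tensor_ract_linearr t : linear (tensor_ract t).
Proof.
move=> k a b /=; move: t; apply: tensor_ext => [|k' x y|m n].
- exact: tensor_lift_linear.
- rewrite /tensor_ract !tensor_lift_linear !scalerDr !scalerA [k' * k]mulrC.
  by rewrite -!addrA; congr (_ + _); rewrite addrCA.
- by rewrite !tensor_ractE ract_linearr mtens_linearr.
Qed.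

Fact tensor_lact1 t : tensor_lact aone t = t.
Proof.
move: t; apply: tensor_ext => // [|m n]; first exact: tensor_lift_linear.
by rewrite tensor_lactE lact1.
Qed.

Fact tensor_lactA a a' t :
  tensor_lact (amul a a') t = tensor_lact a (tensor_lact a' t).
Proof.
move: t; apply: tensor_ext => // [|k x y|m n].
- exact: tensor_lift_linear.
- by rewrite !tensor_lact_linearr.
- by rewrite !tensor_lactE lactA.
Qed.

Fact tensor_ract1 t : tensor_ract t aone = t.
Proof.
move: t; apply: tensor_ext => // [|m n]; first exact: tensor_lift_linear.
by rewrite tensor_ractE ract1.
Qed.

Fact tensor_ractA t c c' :
  tensor_ract t (amul c c') = tensor_ract (tensor_ract t c) c'.
Proof.
move: t; apply: tensor_ext => // [|k x y|m n].
- exact: tensor_lift_linear.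
- by rewrite !tensor_ract_linearl.
- by rewrite !tensor_ractE ractA.
Qed.

Fact tensor_lractA a t c :
  tensor_ract (tensor_lact a t) c = tensor_lact a (tensor_ract t c).
Proof.
move: t; apply: tensor_ext => // [k x y|k x y|m n].
- by rewrite tensor_lact_linearr tensor_ract_linearl.
- by rewrite tensor_ract_linearl tensor_lact_linearr.
- by rewrite tensor_ractE !tensor_lactE tensor_ractE.
Qed.

Fact tensor_grade_lact i j a t :
  a \in grade i -> t \in tensor_grade j ->
  tensor_lact a t \in tensor_grade (i (+) j).
Proof.
move=> ai; move: t; apply: tensor_grade_memv; first exact: tensor_lact_linearr.
move=> i' j' m n <- mi nj; rewrite tensor_lactE addbA.
by apply: mtens_grade => //; exact: grade_lact.
Qed.

Fact tensor_grade_ract i j t c :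
  t \in tensor_grade i -> c \in grade j ->
  tensor_ract t c \in tensor_grade (i (+) j).
Proof.
move=> ti cj; move: t ti.
apply: (@tensor_grade_memv _ (tensor_ract^~ c)); first exact: tensor_ract_linearl.
move=> i' j' m n <- mi nj; rewrite tensor_ractE -addbA.
by apply: mtens_grade => //; exact: grade_ract.
Qed.

HB.instance Definition _ := isBimodule.Build K A C tensor
  tensor_lact_linearl tensor_lact_linearr tensor_ract_linearl tensor_ract_linearr
  tensor_lact1 tensor_lactA tensor_ract1 tensor_ractA tensor_lractA
  tensor_grade_lact tensor_grade_ract.
End TensorProduct.

Notation "M ⊗ N" := (tensor M N) : type_scope.

(* 'Hom(V, W) carries the topology of its matrix entries in bases of V and W,
   which does not depend on the bases. *)
HB.instance Definition _ (K : numFieldType) (V W : vectType K) :=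
  Topological.copy 'Hom(V, W)
    (initial_topology (passmx.mxof (vbasis {:V}) (vbasis {:W}))).

Section Implementers.
Variable K : numFieldType.

Definition even_map (V W : superVectType K) (f : 'Hom(V, W)) : Prop :=
  forall i v, v \in grade i -> f v \in grade i.

Definition Aut (A : superAlgType K) : set 'End(A) :=
  [set phi : 'End(A) | [/\ bijective phi, even_map phi,
    forall x y, phi (amul x y) = amul (phi x) (phi y) & phi aone = aone]].
Arguments Aut : clear implicits.

Definition GL (V : vectType K) : set 'End(V) := [set u : 'End(V) | bijective u].
Arguments GL : clear implicits.

Variables (A B : superAlgType K) (M : bimodType A B).

Definition intertwines (phi : 'End(A)) (u : 'End(M)) (psi : 'End(B)) : Prop :=
  forall a m b, u (a ▷ m ◁ b) = phi a ▷ u m ◁ psi b.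

Definition implementers : set (Aut A * GL M * Aut B) :=
  [set g : Aut A * GL M * Aut B | even_map (set_val g.1.2) /\
    intertwines (set_val g.1.1) (set_val g.1.2) (set_val g.2)].

Definition p_l (g : implementers) : Aut A := (set_val g).1.1.
Definition p_r (g : implementers) : Aut B := (set_val g).2.

Definition open_map (X Y : topologicalType) (f : X -> Y) : Prop :=
  forall U : set X, open U -> open (f @` U).

Definition left_implementing : Prop := open_map p_l.
Definition right_implementing : Prop := open_map p_r.
Definition implementing : Prop := left_implementing /\ right_implementing.
End Implementers.
Arguments Aut {K} A _.
Arguments GL {K} V _.

(* Main.v *)
From HB Require Import structures.
Require Import Defs.
From mathcomp Require Import all_boot all_order all_algebra reals.
From mathcomp Require Import all_classical topology normedtype.

Set Implicit Arguments.
Unset Strict Implicit.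
Unset Printing Implicit Defensive.

Import GRing.Theory.
Import numFieldNormedType.Exports.

Local Open Scope classical_set_scope.
Local Open Scope ring_scope.

(** The idea: an automorphism of [A] close to the identity is transported through
    [M] to an automorphism of [B], and then through [N] to one of [C].

    The projections from the groups of implementers are homomorphisms of
    topological groups, so openness only has to be tested near the identity.
    Let [k = (phi0, w0, chi0)] be an implementer of [M ⊗ N] and let [phi] be
    close to [phi0].  Then [phi phi0^-1] is close to the identity, and
    since [M] is left implementing it lifts to some [(phi phi0^-1, u, psi)] close
    to the identity in [I(M)].  Now [psi] is close to the identity as well, and
    since [N] is left implementing it lifts to some [(psi, v, chi)] close to the
    identity in [I(N)].  As [u] and [v] are twisted by the same [psi], the map
    [u ⊗ v] is well defined on the tensor product over [B], and
    [(phi, (u ⊗ v) w0, chi chi0)] is an implementer close to [k] which lies over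
    [phi], because [(u, v) |-> u ⊗ v] and composition with a fixed map are
    continuous.

    The lemma [imp_tensor_nbhs] turns this closeness into neighbourhoods, and
    [left_implementing_tensor] and [right_implementing_tensor] run the argument
    from the two sides. *)

(** * Continuity of families of linear maps *)

Section HomTopology.
Variables (K : numFieldType) (T : topologicalType).

Lemma continuous_mx (m n : nat) (f : T -> 'M[K]_(m, n)) :
  (forall i j, continuous (fun t => f t i j)) -> continuous f.
Proof.
move=> cf t U [P Pf sPU]; rewrite nbhs_simpl /=.
suff H : \forall s \near t, forall i j, P i j (f s i j).
  by near=> s; apply: sPU; near: s.
by apply: filter_forall => i; apply: filter_forall => j; apply: cf.
Unshelve. all: end_near. Qed.

(** Continuity of a vector-valued map, without putting a topology on a general
    [vectType]. *)
Definition coordwise_continuous (V : vectType K) (f : T -> V) : Prop :=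
  forall j, continuous (fun t => coord (vbasis {:V}) j (f t)).

Lemma mxof_coord (V W : vectType K) (e : (\dim {:V}).-tuple V)
    (e' : (\dim {:W}).-tuple W) (h : 'Hom(V, W)) i j :
  passmx.mxof e e' h i j = coord e' j (h e`_i).
Proof. by rewrite !mxE /= passmx.vecof_delta. Qed.

(** The topology of ['Hom(V, W)] is that of the matrix entries, and these are the
    coordinates of the values at the vectors of a basis. *)
Lemma Hom_continuous (V W : vectType K) (f : T -> 'Hom(V, W)) :
  (forall v, coordwise_continuous (fun t => f t v)) -> continuous f.
Proof.
move=> cf; apply: continuous_comp_initial; apply: continuous_mx => i j.
rewrite [X in continuous X](_ : _ =
  fun t => coord (vbasis {:W}) j (f t (vbasis {:V})`_i)); first exact: cf.
by apply/funext => t /=; rewrite mxof_coord.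
Qed.

Lemma coordwise_continuous_sum (V : vectType K) (I : Type) (r : seq I)
    (f : I -> T -> V) :
  (forall i, coordwise_continuous (f i)) ->
  coordwise_continuous (fun t => \sum_(i <- r) f i t).
Proof.
move=> cf j.
under [X in continuous X]funext => t do rewrite linear_sum /=.
by apply: continuous_big => [|i _]; [exact: add_continuous | exact: cf].
Qed.

Lemma coordwise_continuousZ (V : vectType K) (k : T -> K) (f : T -> V) :
  continuous k -> coordwise_continuous f ->
  coordwise_continuous (fun t => k t *: f t).
Proof.
move=> ck cf j.
under [X in continuous X]funext => t do rewrite linearZ /=.
by move=> t; apply: continuousM; [exact: ck | exact: cf].
Qed.

Lemma coordwise_continuous_cst (V : vectType K) (v : V) :
  coordwise_continuous (fun _ : T => v).
Proof. by move=> j t; exact: cst_continuous. Qed.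

Lemma coordwise_continuous_linear (V W : vectType K) (g : V -> W)
    (f : T -> V) :
  linear g -> coordwise_continuous f -> coordwise_continuous (g \o f).
Proof.
move=> lg cf.
under [X in coordwise_continuous X]funext => t do
  rewrite /= (linear_coord (f t) lg).
apply: coordwise_continuous_sum => i; apply: coordwise_continuousZ => //.
exact: coordwise_continuous_cst.
Qed.

Lemma coordwise_continuous_bilinear (V V' W : vectType K)
    (beta : V -> V' -> W) (f : T -> V) (g : T -> V') :
  (forall y, linear (beta^~ y)) -> (forall x, linear (beta x)) ->
  coordwise_continuous f -> coordwise_continuous g ->
  coordwise_continuous (fun t => beta (f t) (g t)).
Proof.
move=> ll lr cf cg.
under [X in coordwise_continuous X]funext => t do
  rewrite (linear_coord (f t) (ll (g t))).
apply: coordwise_continuous_sum => i; apply: coordwise_continuousZ => //.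
exact: coordwise_continuous_linear.
Qed.

Lemma coordwise_continuous_app (V W : vectType K) (f : T -> 'Hom(V, W)) v :
  continuous f -> coordwise_continuous (fun t => f t v).
Proof.
move=> cf.
under [X in coordwise_continuous X]funext => t do
  rewrite (linear_coord v (@linearP _ _ _ _ (f t))).
apply: coordwise_continuous_sum => i.
apply: coordwise_continuousZ => [t|j]; first exact: cst_continuous.
rewrite [X in continuous X](_ : _ =
  (fun M : 'M[K]_(_, _) => M i j) \o
  (passmx.mxof (vbasis {:V}) (vbasis {:W}) \o f)); last first.
  by apply/funext => t /=; rewrite mxof_coord.
move=> t; apply: continuous_comp; last exact: coord_continuous.
by apply: continuous_comp; [exact: cf | exact: initial_continuous].
Qed.

Lemma comp_lfunr_continuous (U V W : vectType K) (f : T -> 'Hom(V, W))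
    (g : 'Hom(U, V)) :
  continuous f -> continuous (fun t => (f t \o g)%VF).
Proof.
move=> cf; apply: Hom_continuous => v.
under [X in coordwise_continuous X]funext => t do rewrite comp_lfunE.
exact: coordwise_continuous_app.
Qed.
End HomTopology.

(** * The tensor product of two linear maps *)

Section TensorMap.
Variables (K : fieldType) (A B C : superAlgType K).
Variables (M : bimodType A B) (N : bimodType B C).
Implicit Types (u : 'End(M)) (v : 'End(N)).

HB.instance Definition _ (W : vectType K) (beta : M -> N -> W) :=
  GRing.isLinear.Build K (M ⊗ N) W _ (tensor_lift beta)
    (tensor_lift_linear beta).

(** Defined for every pair of linear maps, so that continuity in the pair makes
    sense on the whole product; it has the expected values on elementary tensors
    when [u] and [v] are compatible, see [tensor_mapE]. *)
Definition tensor_map u v : 'End(M ⊗ N) :=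
  linfun (tensor_lift (fun m n => mtens (u m) (v n))).

(** The common twist [psi] is what makes [(m, n) |-> u m ⊗ v n] balanced over
    [B]: it moves from one factor to the other. *)
Lemma tensor_mapE u v (psi : B -> B) :
  (forall m b, u (m ◁ b) = u m ◁ psi b) ->
  (forall b n, v (b ▷ n) = psi b ▷ v n) ->
  forall m n, tensor_map u v (mtens m n) = mtens (u m) (v n).
Proof.
move=> uP vP m n; rewrite lfunE /=.
apply: tensor_liftE => [n' k x y|m' k x y|m' b n'].
- by rewrite linearP mtens_linearl.
- by rewrite linearP mtens_linearr.
- by rewrite uP vP mtens_balanced.
Qed.
End TensorMap.

(** [tensor_map u v] is bilinear in the pair [(u, v)], because its value at a
    tensor is a sum over the coordinates of that tensor. *)
Lemma tensor_map_continuous (K : numFieldType) (A B C : superAlgType K)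
    (M : bimodType A B) (N : bimodType B C) (T : topologicalType)
    (u : T -> 'End(M)) (v : T -> 'End(N)) :
  continuous u -> continuous v -> continuous (fun t => tensor_map (u t) (v t)).
Proof.
move=> cu cv; apply: Hom_continuous => x.
under [X in coordwise_continuous X]funext => t do
  rewrite lfunE /= /tensor_lift /outer_lift.
apply: coordwise_continuous_sum => i; apply: coordwise_continuous_sum => j.
apply: coordwise_continuousZ => [t|]; first exact: cst_continuous.
apply: coordwise_continuous_bilinear.
- exact: mtens_linearl.
- exact: mtens_linearr.
- exact: coordwise_continuous_app.
- exact: coordwise_continuous_app.
Qed.

(** * The groups of automorphisms *)

Section Groups.
Variable K : numFieldType.

Lemma lfun_bijective_surj (V : vectType K) (f : 'End(V)) :
  limg f = fullv -> bijective f.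
Proof.
move=> ff; have kf : lker f == 0%VS.
  rewrite -dimv_eq0; have := limg_ker_dim f fullv.
  by rewrite capfv ff -[RHS]add0n => /eqP; rewrite eqn_add2r.
by exists (f^-1)%VF; [exact: lker0_lfunK | exact: lker0_lfunVK].
Qed.

Lemma lfun_bijective_comp (V : vectType K) (f g : 'End(V)) :
  bijective f -> bijective g -> bijective (f \o g)%VF.
Proof.
move=> bf bg; apply: (eq_bij (bij_comp bf bg)) => x /=.
by rewrite comp_lfunE.
Qed.

Lemma even_map_comp (U V W : superVectType K) (f : 'Hom(V, W))
    (g : 'Hom(U, V)) :
  even_map f -> even_map g -> even_map (f \o g)%VF.
Proof. by move=> ef eg i v vi; rewrite comp_lfunE; apply/ef/eg. Qed.

Lemma bijective_lfunK (V : vectType K) (f : 'End(V)) :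
  bijective f -> cancel f (f^-1)%VF /\ cancel (f^-1)%VF f.
Proof.
move=> /bij_inj/lker0P kf.
by split; [exact: lker0_lfunK | exact: lker0_lfunVK].
Qed.

Lemma proj_grade_even (V W : superVectType K) (f : 'Hom(V, W)) i x :
  even_map f -> proj_grade i (f x) = f (proj_grade i x).
Proof.
move=> ef; rewrite {1}(proj_grade_sum i x) linearD /=.
by apply: proj_gradeD; apply/ef/proj_grade_mem.
Qed.

Section Automorphisms.
Variable A : superAlgType K.

Lemma Aut_id : Aut A \1%VF.
Proof.
split => [|i x|x y|]; rewrite ?id_lfunE //.
by exists id => x; rewrite id_lfunE.
Qed.

Lemma Aut_comp (f g : 'End(A)) : Aut A f -> Aut A g -> Aut A (f \o g)%VF.
Proof.
move=> [bf ef mf f1] [bg eg mg g1]; split.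
- exact: lfun_bijective_comp.
- exact: even_map_comp.
- by move=> x y; rewrite !comp_lfunE mg mf.
- by rewrite comp_lfunE g1.
Qed.

(** The inverse is even because [f] commutes with the projections onto the graded
    parts: for [v] of degree [i], the wrong component of [f^-1 v] is sent to the
    wrong component of [v], which vanishes. *)
Lemma Aut_inv (f : 'End(A)) : Aut A f -> Aut A (f^-1)%VF.
Proof.
move=> [bf ef mf f1]; have [fK fVK] := bijective_lfunK bf.
split.
- by exists f.
- move=> i v vi.
  have e0 : proj_grade (~~ i) (f^-1%VF v) = 0.
    apply: (bij_inj bf); rewrite linear0 -proj_grade_even // fVK.
    by apply: proj_grade0; rewrite negbK.
  by rewrite (proj_grade_sum i (f^-1%VF v)) e0 addr0 proj_grade_mem.
- by move=> x y; apply: (bij_inj bf); rewrite mf !fVK.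
- by apply: (bij_inj bf); rewrite f1 fVK.
Qed.

Definition aut_id : Aut A := SigSub (mem_set Aut_id).
Definition aut_comp (f g : Aut A) : Aut A :=
  SigSub (mem_set (Aut_comp (set_valP f) (set_valP g))).
Definition aut_inv (f : Aut A) : Aut A :=
  SigSub (mem_set (Aut_inv (set_valP f))).

Lemma aut_compA : associative aut_comp.
Proof. by move=> f g h; apply: val_inj; rewrite /= comp_lfunA. Qed.

Lemma aut_comp1f : left_id aut_id aut_comp.
Proof. by move=> f; apply: val_inj; rewrite /= comp_lfun1l. Qed.

Lemma aut_compf1 : right_id aut_id aut_comp.
Proof. by move=> f; apply: val_inj; rewrite /= comp_lfun1r. Qed.

Lemma aut_compfV (f : Aut A) : aut_comp f (aut_inv f) = aut_id.
Proof.
have [bf _ _ _] := set_valP f; apply: val_inj => /=.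
exact/lker0_compfV/lker0P/bij_inj.
Qed.

Lemma aut_compVf (f : Aut A) : aut_comp (aut_inv f) f = aut_id.
Proof.
have [bf _ _ _] := set_valP f; apply: val_inj => /=.
exact/lker0_compVf/lker0P/bij_inj.
Qed.

Lemma aut_comp_continuousl (g : Aut A) : continuous (aut_comp^~ g).
Proof.
apply: continuous_comp_initial; apply: comp_lfunr_continuous.
exact: initial_continuous.
Qed.

(** Translation reduces neighbourhoods of [f] to neighbourhoods of the
    identity. *)
Lemma nbhs_aut_translate (f : Aut A) (X : set (Aut A)) :
  nbhs aut_id X -> nbhs f [set h | X (aut_comp h (aut_inv f))].
Proof.
rewrite -(aut_compfV f) => nX.
exact: (@aut_comp_continuousl (aut_inv f) f X nX).
Qed.
End Automorphisms.
End Groups.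

(** * The group of implementers *)

Local Notation Imp M := (@implementers _ _ _ M).

Section ImplementerGroup.
Variables (K : numFieldType) (A B : superAlgType K) (M : bimodType A B).
Implicit Types g h : Imp M.

Definition p_m g : 'End(M) := set_val (set_val g).1.2.

Lemma p_m_bij g : bijective (p_m g).
Proof. exact: (set_valP (set_val g).1.2). Qed.

Lemma p_m_even g : even_map (p_m g).
Proof. by have [] := set_valP g. Qed.

Lemma p_m_intertwines g :
  intertwines (set_val (p_l g)) (p_m g) (set_val (p_r g)).
Proof. by have [] := set_valP g. Qed.

(** An implementer intertwines each action separately, as automorphisms preserve
    the unit. *)
Lemma p_m_lact g a m : p_m g (a ▷ m) = set_val (p_l g) a ▷ p_m g m.
Proof.
have [_ _ _ psi1] := set_valP (p_r g).
by rewrite -[a ▷ m]ract1 p_m_intertwines psi1 ract1.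
Qed.

Lemma p_m_ract g m b : p_m g (m ◁ b) = p_m g m ◁ set_val (p_r g) b.
Proof.
have [_ _ _ phi1] := set_valP (p_l g).
by rewrite -{1}[m]lact1 p_m_intertwines phi1 lact1.
Qed.

Definition implementer (phi : Aut A) (u : 'End(M)) (psi : Aut B)
    (bu : bijective u) (eu : even_map u)
    (iu : intertwines (set_val phi) u (set_val psi)) : Imp M :=
  SigSub (mem_set (conj eu iu :
    Imp M (phi, SigSub (mem_set (bu : GL M u)), psi))).

Lemma imp_id_bij : bijective (\1%VF : 'End(M)).
Proof. by exists id => x; rewrite id_lfunE. Qed.

Lemma imp_id_even : even_map (\1%VF : 'End(M)).
Proof. by move=> i x; rewrite id_lfunE. Qed.

Lemma imp_id_intertwines :
  intertwines (set_val (aut_id A)) (\1%VF : 'End(M)) (set_val (aut_id B)).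
Proof. by move=> a m b; rewrite !id_lfunE. Qed.

Definition imp_id : Imp M :=
  implementer imp_id_bij imp_id_even imp_id_intertwines.

Lemma imp_comp_intertwines g h :
  intertwines (set_val (aut_comp (p_l g) (p_l h))) (p_m g \o p_m h)%VF
    (set_val (aut_comp (p_r g) (p_r h))).
Proof. by move=> a m b; rewrite !comp_lfunE !p_m_intertwines. Qed.

Definition imp_comp g h : Imp M :=
  implementer (lfun_bijective_comp (p_m_bij g) (p_m_bij h))
    (even_map_comp (p_m_even g) (p_m_even h))
    (imp_comp_intertwines g h).

Lemma p_l_continuous : continuous (@p_l _ _ _ M).
Proof.
move=> g; apply: (continuous_comp (g := fst \o fst)).
  exact: initial_continuous.
by apply: continuous_comp; exact: cvg_fst.
Qed.

Lemma p_r_continuous : continuous (@p_r _ _ _ M).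
Proof.
move=> g; apply: (continuous_comp (g := snd)); last exact: cvg_snd.
exact: initial_continuous.
Qed.

Lemma p_m_continuous : continuous p_m.
Proof.
move=> g; apply: (continuous_comp (g := set_val \o snd \o fst)).
  exact: initial_continuous.
apply: (continuous_comp (f := snd \o fst)); last exact: initial_continuous.
by apply: continuous_comp; [exact: cvg_fst | exact: cvg_snd].
Qed.

(** The topology of the implementers is induced by the three components; the
    components in the two [Aut] groups may be tested there, and the middle one in
    ['End(M)]. *)
Lemma implementers_nbhs g (U : set (Imp M)) : nbhs g U ->
  exists P Q S, [/\ nbhs (p_l g) P, nbhs (p_m g) Q, nbhs (p_r g) S &
    forall h, P (p_l h) -> Q (p_m h) -> S (p_r h) -> U h].
Proof.
case=> _ /= [[W oW <-] Wg WU].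
have [[PQ S] /= [[[P Q'] /= [nP nQ'] sPQ] nS] sW] : nbhs (set_val g) W.
  exact: open_nbhs_nbhs.
have [_ /= [[Q oQ <-] Qg QQ']] := nQ'.
exists P, Q, S; split => // [|h Ph Qh Sh]; first exact: open_nbhs_nbhs.
apply: WU; apply: sW; split => //; apply: sPQ; split => //.
exact: QQ'.
Qed.
End ImplementerGroup.

(** * Implementers of a tensor product *)

Lemma open_mapP (X Y : topologicalType) (f : X -> Y) :
  open_map f <-> forall x U, nbhs x U -> nbhs (f x) (f @` U).
Proof.
split=> [fo x U|fo U oU].
  rewrite nbhsE => -[V [oV Vx] VU]; rewrite nbhsE; exists (f @` V).
    by split; [exact: fo | exists x].
  exact: image_subset.
by rewrite openE => _ [x Ux <-]; apply/fo/open_nbhs_nbhs.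
Qed.

Section TensorImplementers.
Variables (K : numFieldType) (A B C : superAlgType K).
Variables (M : bimodType A B) (N : bimodType B C).

Section Tensor.
Variables (g : Imp M) (h : Imp N).
Hypothesis gh : p_r g = p_l h.

Lemma imp_tensorE m n :
  tensor_map (p_m g) (p_m h) (mtens m n) = mtens (p_m g m) (p_m h n).
Proof.
apply: (tensor_mapE (psi := set_val (p_r g))); first exact: p_m_ract.
by move=> b n'; rewrite gh p_m_lact.
Qed.

(** Surjectivity is enough in finite dimension, and the image contains every
    elementary tensor, as [p_m g] and [p_m h] are onto. *)
Lemma imp_tensor_bij : bijective (tensor_map (p_m g) (p_m h)).
Proof.
apply: lfun_bijective_surj; apply/vspaceP => t; rewrite memvf; move: t.
apply: (@tensor_memv _ _ _ _ _ _ _ id) => // m n.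
have [_ gVK] := bijective_lfunK (p_m_bij g).
have [_ hVK] := bijective_lfunK (p_m_bij h).
by rewrite -[m]gVK -[n]hVK -imp_tensorE memv_img ?memvf.
Qed.

Lemma imp_tensor_even : even_map (tensor_map (p_m g) (p_m h)).
Proof.
move=> k; apply: tensor_grade_memv => [x s t|i j m n <- mi nj].
  by rewrite linearP.
by rewrite imp_tensorE; apply: mtens_grade; exact: p_m_even.
Qed.

Lemma imp_tensor_intertwines :
  intertwines (set_val (p_l g)) (tensor_map (p_m g) (p_m h))
    (set_val (p_r h)).
Proof.
move=> a t c; move: t; apply: tensor_ext => [x s t|x s t|m n].
- by rewrite lact_linearr ract_linearl linearP.
- by rewrite linearP lact_linearr ract_linearl.
- rewrite imp_tensorE.
  rewrite [a ▷ _]tensor_lactE [_ ◁ c]tensor_ractE imp_tensorE.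
  rewrite [_ ▷ mtens _ _]tensor_lactE [RHS]tensor_ractE.
  by rewrite p_m_lact p_m_ract.
Qed.

Definition imp_tensor : Imp (M ⊗ N) :=
  implementer imp_tensor_bij imp_tensor_even imp_tensor_intertwines.
End Tensor.

(** The map [(g, h) |-> (g ⊗ h) k] is continuous and sends the pair of identities
    to [k].  It is only defined on pairs with a common automorphism of [B], so
    continuity is obtained componentwise on the full product [I(M) * I(N)], where
    the components still make sense. *)
Lemma imp_tensor_nbhs (k : Imp (M ⊗ N)) U : nbhs k U ->
  exists V W, [/\ nbhs (imp_id M) V, nbhs (imp_id N) W &
    forall g h (gh : p_r g = p_l h), V g -> W h ->
      U (imp_comp (imp_tensor gh) k)].
Proof.
move=> /implementers_nbhs[P [Q [S [nP nQ nS sU]]]].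
pose u (gh : Imp M * Imp N) : 'End(M ⊗ N) :=
  (tensor_map (p_m gh.1) (p_m gh.2) \o p_m k)%VF.
have cu : continuous u.
  apply: comp_lfunr_continuous; apply: tensor_map_continuous => gh.
    apply: continuous_comp; [exact: cvg_fst | exact: p_m_continuous].
  apply: continuous_comp; [exact: cvg_snd | exact: p_m_continuous].
have u1 : u (imp_id M, imp_id N) = p_m k.
  rewrite /u -[RHS]comp_lfun1l; congr (_ \o _)%VF.
  apply/lfunP; apply: tensor_ext => [x s t|x s t|m n]; rewrite ?linearP //.
  by rewrite imp_tensorE // !id_lfunE.
have /cu : nbhs (u (imp_id M, imp_id N)) Q by rewrite u1.
move=> [[V W] /= [nV nW] sQ].
pose cl (g : Imp M) := aut_comp (p_l g) (p_l k).
have ccl : continuous cl.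
  move=> g.
  exact: (continuous_comp (@p_l_continuous _ _ _ _ g)
    (@aut_comp_continuousl _ _ _ _)).
have cl1 : cl (imp_id M) = p_l k by exact: aut_comp1f.
have /ccl ncl : nbhs (cl (imp_id M)) P by rewrite cl1.
pose cr (h : Imp N) := aut_comp (p_r h) (p_r k).
have ccr : continuous cr.
  move=> h.
  exact: (continuous_comp (@p_r_continuous _ _ _ _ h)
    (@aut_comp_continuousl _ _ _ _)).
have cr1 : cr (imp_id N) = p_r k by exact: aut_comp1f.
have /ccr ncr : nbhs (cr (imp_id N)) S by rewrite cr1.
exists (V `&` cl @^-1` P), (W `&` cr @^-1` S); split.
- exact: filterI.
- exact: filterI.
- move=> g h gh [Vg Pg] [Wh Sh]; apply: sU => //.
  exact: (sQ (g, h)).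
Qed.

(** The lift to [I(M)] is chosen so that its automorphism of [B] belongs to the
    image under [p_l] of the prescribed neighbourhood in [I(N)], which is a
    neighbourhood of the identity because [N] is left implementing. *)
Lemma left_implementing_tensor :
  left_implementing M -> left_implementing N -> left_implementing (M ⊗ N).
Proof.
move=> /open_mapP lM /open_mapP lN.
apply/open_mapP => k U /imp_tensor_nbhs[V [W [nV /lN nW sU]]].
have /lM : nbhs (imp_id M) (V `&` @p_r _ _ _ M @^-1` (@p_l _ _ _ N @` W)).
  apply: filterI => //.
  by have /p_r_continuous : nbhs (p_r (imp_id M)) (@p_l _ _ _ N @` W) := nW.
move=> /nbhs_aut_translate nX; apply: filterS (nX _).
move=> phi [g [Vg [h Wh hg]] gphi].
exists (imp_comp (imp_tensor (esym hg)) k); first exact: sU.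
rewrite [LHS](_ : _ = aut_comp (p_l g) (p_l k)) //.
by rewrite gphi -aut_compA aut_compVf aut_compf1.
Qed.

(** The mirror image: the lift to [I(N)] is chosen first, so that its automorphism
    of [B] belongs to the image under [p_r] of the neighbourhood in [I(M)]. *)
Lemma right_implementing_tensor :
  right_implementing M -> right_implementing N -> right_implementing (M ⊗ N).
Proof.
move=> /open_mapP rM /open_mapP rN.
apply/open_mapP => k U /imp_tensor_nbhs[V [W [/rM nV nW sU]]].
have /rN : nbhs (imp_id N) (W `&` @p_l _ _ _ N @^-1` (@p_r _ _ _ M @` V)).
  apply: filterI => //.
  by have /p_l_continuous : nbhs (p_l (imp_id N)) (@p_r _ _ _ M @` V) := nV.
move=> /nbhs_aut_translate nX; apply: filterS (nX _).
move=> chi [h [Wh [g Vg gh]] hchi].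
exists (imp_comp (imp_tensor gh) k); first exact: sU.
rewrite [LHS](_ : _ = aut_comp (p_r h) (p_r k)) //.
by rewrite hchi -aut_compA aut_compVf aut_compf1.
Qed.
End TensorImplementers.

Theorem proposition3p2p1 (R : realType) (K : numFieldType)
    (hK : real_or_complex R K) (A B C : superAlgType K)
    (M : bimodType A B) (N : bimodType B C) :
  [/\ implementing M -> left_implementing N -> left_implementing (M ⊗ N),
      right_implementing M -> implementing N -> right_implementing (M ⊗ N)
    & implementing M -> implementing N -> implementing (M ⊗ N)].
Proof.
split=> [[lM _] lN|rM [_ rN]|[lM rM] [lN rN]].
- exact: left_implementing_tensor.
- exact: right_implementing_tensor.
- by split; [exact: left_implementing_tensor | exact: right_implementing_tensor].
Qed.
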